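(* Let $\mathcal{C}$ be a cone of formal languages all of whose members are semilinear languages. Let $G$ be a finitely generated virtually nilpotent group. If the word problem $\operatorname{WP}(G)$ of $G$ is in $\mathcal{C}$, then $G$ is virtually abelian.
   Context: An alphabet is a finite nonempty set $\Sigma$; a (formal) language over $\Sigma$ is a subset of the free monoid $\Sigma^*$. Regular languages are those accepted by finite automata. Word problem: a choice of generators for a group $G$ is a surjective monoid homomorphism $\pi:\Sigma^*\to G$, where the finite alphabet $\Sigma$ is equipped with a fixed-point-free involution $a\mapsto a^{-1}$ satisfying $\pi(a^{-1})=\pi(a)^{-1}$ for all $a\in\Sigma$. The word problem of $G$ is the language $\operatorname{WP}(G)=\pi^{-1}(1)\subset\Sigma^*$. It depends on the choice of generators, but whether or not it lies in a given cone of languages (defined below) does not. Cone: a class $\mathcal{C}$ of languages (over finite alphabets) is a cone if it contains at least one nonempty language and, for all finite alphabets $\Sigma_1,\Sigma_2$ and every monoid homomorphism $\sigma:\Sigma_1^*\to\Sigma_2^*$: (1) if $L\subset\Sigma_1^*$ is in $\mathcal{C}$ then $\sigma(L)$ is in $\mathcal{C}$; (2) if $L\subset\Sigma_2^*$ is in $\mathcal{C}$ then $\sigma^{-1}(L)$ is in $\mathcal{C}$; (3) if $L\subset\Sigma_1^*$ is in $\mathcal{C}$ and $R\subset\Sigma_1^*$ is regular then $L\cap R$ is in $\mathcal{C}$. Semilinearity: let $\mathbb{N}$ be the non-negative integers. A linear subset of $\mathbb{N}^k$ is a set $v_0+\langle v_1,\dots,v_m\rangle$, i.e. a translate by $v_0\in\mathbb{N}^k$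 of the submonoid generated by finitely many vectors $v_1,\dots,v_m\in\mathbb{N}^k$. A semilinear subset of $\mathbb{N}^k$ is a finite union of linear subsets. For $\Sigma=\{a_1,\dots,a_k\}$ the Parikh map $\psi:\Sigma^*\to\mathbb{N}^k$ sends $w$ to $(|w|_1,\dots,|w|_k)$, where $|w|_i$ is the number of occurrences of $a_i$ in $w$. A language $L\subset\Sigma^*$ is semilinear if $\psi(L)$ is a semilinear subset of $\mathbb{N}^k$. *)

(* Defs.v *)
From mathcomp Require Import all_boot all_order all_algebra.
From mathcomp Require Import boolp classical_sets cardinality.

Set Implicit Arguments.
Unset Strict Implicit.
Unset Printing Implicit Defensive.

Local Open Scope classical_set_scope.

Section Groups.
Variable G : groupType.
Local Open Scope group_scope.
Implicit Types (H K A : set G).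

Definition subgroup H : Prop := group_closed (mem H).

Definition generated A : set G := smallest subgroup A.

Definition finitely_generated : Prop :=
  exists s : seq G, generated [set` s] = setT.

Definition left_coset H (x : G) : set G := [set x * h | h in H].

Definition finite_index H : Prop := finite_set (range (left_coset H)).

Definition commutator H K : set G :=
  generated [set [~ h, k] | h in H & k in K].

(* Numbered from 0: lower_central H 0 is H itself. *)
Fixpoint lower_central H (n : nat) : set G :=
  if n is m.+1 then commutator (lower_central H m) H else H.

Definition abelian_subgroup H : Prop :=
  forall x y, H x -> H y -> commute x y.

Definition nilpotent_subgroup H : Prop :=
  exists c : nat, lower_central H c = [set 1].

Definition virtually (P : set G -> Prop) : Prop :=
  exists H, [/\ subgroup H, finite_index H & P H].

End Groups.

Arguments finitely_generated G : clear implicits.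

Definition virtually_abelian (G : groupType) : Prop :=
  virtually (@abelian_subgroup G).

Definition virtually_nilpotent (G : groupType) : Prop :=
  virtually (@nilpotent_subgroup G).

Record alphabet := Alphabet {
  letter :> finType;
  alphabet_gt0 : (0 < #|letter|)%N
}.

Definition language (Sigma : alphabet) : Type := set (seq Sigma).

Definition word_morphism (S1 S2 : alphabet) (f : seq S1 -> seq S2) : Prop :=
  f [::] = [::] /\ {morph f : u v / u ++ v}.

Record automaton (Sigma : alphabet) := Automaton {
  state : finType;
  initial : state;
  accepting : {set state};
  transition : state -> Sigma -> state
}.

Definition accepted (Sigma : alphabet) (M : automaton Sigma) : language Sigma :=
  [set w | foldl (@transition Sigma M) (initial M) w \in accepting M].

Definition regular (Sigma : alphabet) (L : language Sigma) : Prop :=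
  exists M : automaton Sigma, L = accepted M.

Definition language_class := forall Sigma : alphabet, set (language Sigma).

Record cone (C : language_class) : Prop := Cone {
  cone_nonempty : exists (S : alphabet) (L : language S), C S L /\ L !=set0;
  cone_image : forall (S1 S2 : alphabet) (f : seq S1 -> seq S2),
    word_morphism f -> forall L : language S1, C S1 L -> C S2 (f @` L);
  cone_preimage : forall (S1 S2 : alphabet) (f : seq S1 -> seq S2),
    word_morphism f -> forall L : language S2, C S2 L -> C S1 (f @^-1` L);
  cone_regular : forall (S1 : alphabet) (L R : language S1),
    C S1 L -> regular R -> C S1 (L `&` R)
}.

Section Semilinear.
Local Open Scope ring_scope.

Definition submonoid k (M : set 'rV[nat]_k) : Prop := Algebra.nmod_closed (mem M).

Definition linear_set k (A : set 'rV[nat]_k) : Prop :=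
  exists (v0 : 'rV[nat]_k) (vs : seq 'rV[nat]_k),
    A = [set v0 + v | v in smallest (@submonoid k) [set` vs]].

Definition semilinear_set k (A : set 'rV[nat]_k) : Prop :=
  exists (m : nat) (B : 'I_m -> set 'rV[nat]_k),
    (forall i, linear_set (B i)) /\ A = \bigcup_i B i.

(* The k letters of Sigma are numbered by the enumeration of its finType. *)
Definition parikh (Sigma : alphabet) (w : seq Sigma) : 'rV[nat]_#|Sigma| :=
  \row_i count_mem (enum_val i) w.

Definition semilinear_language (Sigma : alphabet) (L : language Sigma) : Prop :=
  semilinear_set (@parikh Sigma @` L).

End Semilinear.

Record choice_of_generators (G : groupType) (Sigma : alphabet)
    (inv : Sigma -> Sigma) (pi : seq Sigma -> G) : Prop := ChoiceOfGenerators {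
  inv_involutive : involutive inv;
  inv_fixed_point_free : forall a, inv a <> a;
  generators_nil : pi [::] = 1%g;
  generators_cat : {morph pi : u v / u ++ v >-> (u * v)%g};
  generators_surjective : forall g, exists w, pi w = g;
  generators_inv : forall a, pi [:: inv a] = ((pi [:: a])^-1)%g
}.

Definition word_problem (G : groupType) (Sigma : alphabet)
    (pi : seq Sigma -> G) : language Sigma :=
  pi @^-1` [set 1%g].

(* Main.v *)
Require Import Defs.
From mathcomp Require Import all_boot all_order all_algebra.
From mathcomp Require Import boolp classical_sets cardinality.
From mathcomp Require Import zify.

(** Call x, y a Heisenberg pair when z = [x, y] commutes with x and y and has
    infinite order, i.e. when x and y generate a discrete Heisenberg group.

    A group with a Heisenberg pair has no word problem in a cone of semilinear
    languages.  Pull the word problem back along a morphism from the free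
    monoid on five letters that sends the letters to words for x, y, x^-1,
    y^-1, z^-1, and intersect with the regular language of the words in which
    the letters occur in this order.  Since x^a y^b = y^b x^a z^(ab), the
    Parikh image of the resulting language is the set of the vectors
    (a, b, a, b, ab) ([Heisenberg_word], [Heisenberg_relation]).  It is not
    semilinear: a linear set on which the product of two coordinates is a third
    one contains at most one point where these two coordinates agree, because
    no period can increase both of them, and sums of periods are periods
    ([linear_set_diagonal], [multiplication_graph_not_semilinear]).

    Conversely, if G is finitely generated, virtually nilpotent and without
    Heisenberg pairs, then G is virtually abelian
    ([virtually_abelian_of_nilpotent]).  The class of a nilpotent subgroup of
    finite index can be lowered as long as it is at least 2.  Let K be a
    finitely generated one ([Schreier]) such that [lower_central K n.+2] is
    trivial, i.e. [lower_central K n.+1] is central.  For g in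
    [lower_central K n], the map h |-> [g, h] is a morphism from K to the center of K.  Its values are torsion because
    there are no Heisenberg pairs, so its image, generated by finitely many
    commuting torsion elements, is finite and the centralizer of g has finite
    index.  Only finitely many g matter, since [lower_central K n] is finitely
    generated modulo the central subgroup [lower_central K n.+1]
    ([lower_central_generators]).  The intersection of their centralizers in K
    has finite index and centralizes [lower_central K n], hence has smaller
    class. *)

Set Implicit Arguments.
Unset Strict Implicit.
Unset Printing Implicit Defensive.

Local Open Scope classical_set_scope.

Definition no_Heisenberg_pair (G : groupType) : Prop :=
  forall x y : G, commute x [~ x, y]%g -> commute y [~ x, y]%g ->
  exists n : nat, (0 < n)%N /\ ([~ x, y] ^+ n = 1)%g.

(** * Subgroups and the lower central series *)

Section GroupTheory.
Variable G : groupType.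
Local Open Scope group_scope.
Implicit Types (H K Q A : set G).

Lemma subgroupP H :
  subgroup H <-> [/\ H 1, forall x y, H x -> H y -> H (x * y)
                        & forall x, H x -> H x^-1].
Proof.
split=> [gH|[H1 HM HV]].
  have [/set_mem H1 _] := gH; split=> // [x y Hx Hy|x Hx]; apply: set_mem.
    exact: (group_closedM gH) (mem_set Hx) (mem_set Hy).
  exact: (group_closedV gH) (mem_set Hx).
split; first exact: mem_set.
by move=> x y /set_mem Hx /set_mem Hy; apply: mem_set; apply: HM => //; apply: HV.
Qed.

Lemma generated_subgroup A : subgroup (generated A).
Proof.
apply/subgroupP; split=> [|x y Ax Ay|x Ax] B [gB sAB];
  have [B1 BM BV] := (subgroupP B).1 gB => //.
- by apply: BM; [apply: Ax|apply: Ay].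
- by apply: BV; apply: Ax.
Qed.

Lemma subgroupJ H x h : subgroup H -> H x -> H h -> H (x ^ h).
Proof.
move=> /subgroupP[_ HM HV] Hx Hh.
by apply: (HM); [apply: HV|apply: HM].
Qed.

Lemma commMg (x y z : G) : [~ x * y, z] = [~ x, z] ^ y * [~ y, z].
Proof. by rewrite /commg /conjg !invgM -!mulgA !mulVKg. Qed.

Lemma commVg (x z : G) : [~ x^-1, z] = ([~ x, z]^-1) ^ x^-1.
Proof. by rewrite /commg /conjg !invgM !invgK -!mulgA mulgV mulg1. Qed.

(** This is the centralizer of A modulo Q.  Inclusion in a subgroup only has to be
    checked on generators, which is how statements on commutators are reduced to
    generators in each of the two arguments. *)
Lemma commutator_mod_subgroup K A Q :
    subgroup K -> subgroup Q -> (forall x h, Q x -> K h -> Q (x ^ h)) ->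
  subgroup [set x | K x /\ forall a, A a -> Q [~ x, a]].
Proof.
move=> /subgroupP[K1 KM KV] /subgroupP[Q1 QM QV] nQK; apply/subgroupP; split.
- by split=> // a _; rewrite comm1g.
- move=> x y [Kx Qx] [Ky Qy]; split=> [|a Aa]; first exact: KM.
  by rewrite commMg; apply: (QM); [apply: nQK; [apply: Qx|]|apply: Qy].
- move=> x [Kx Qx]; split=> [|a Aa]; first exact: KV.
  by rewrite commVg; apply: nQK; [apply/QV/Qx|apply: (KV)].
Qed.

Lemma lower_central_subgroup H n : subgroup H -> subgroup (lower_central H n).
Proof. by case: n => // n _; apply: generated_subgroup. Qed.

Lemma lower_centralS H K n :
  H `<=` K -> lower_central H n `<=` lower_central K n.
Proof.
move=> sHK; elim: n => //= n IHn.
apply: smallest_sub; first exact: generated_subgroup.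
move=> _ [x Hx [y Hy <-]]; apply: sub_gen_smallest.
by exists x; [apply: IHn|exists y; [apply: sHK|]].
Qed.

Lemma lower_central_comm H n x y :
  lower_central H n x -> H y -> lower_central H n.+1 [~ x, y].
Proof. by move=> Hx Hy; apply: sub_gen_smallest; exists x => //; exists y. Qed.

Lemma lower_central_conj H n x h :
  subgroup H -> lower_central H n x -> H h -> lower_central H n (x ^ h).
Proof.
move=> gH; elim: n x h => [|n IHn] x h Hx Hh; first exact: subgroupJ.
pose X := [set x | forall h, H h -> lower_central H n.+1 (x ^ h)].
suff: lower_central H n.+1 `<=` X by move/(_ x Hx); apply.
have [L1 LM LV] := (subgroupP _).1 (lower_central_subgroup n.+1 gH).
apply: smallest_sub.
  apply/subgroupP; split=> [k _|a b Xa Xb k Hk|a Xa k Hk]; first by rewrite conj1g.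
    by rewrite conjMg; apply: (LM); [apply: Xa|apply: Xb].
  by rewrite conjVg; apply: (LV); apply: Xa.
move=> _ [a Ha [b Hb <-]] k Hk; rewrite conjRg; apply: lower_central_comm.
  exact: IHn.
exact: subgroupJ.
Qed.

Lemma lower_central_succ_sub H n :
  subgroup H -> lower_central H n.+1 `<=` lower_central H n.
Proof.
move=> gH; have gL := lower_central_subgroup n gH.
have [_ LM LV] := (subgroupP _).1 gL.
apply: smallest_sub => // _ [a Ha [b Hb <-]].
by rewrite /commg; apply: (LM); [apply: (LV)|apply: lower_central_conj].
Qed.

Lemma lower_central_sub H n : subgroup H -> lower_central H n `<=` H.
Proof.
move=> gH; elim: n => // n IHn.
by apply: subset_trans IHn; apply: lower_central_succ_sub.
Qed.

(** Modulo the term n + 2, the commutator map from (term n) x K to the term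
    n + 1 is multiplicative in both arguments, and it is trivial when the first
    argument lies in the term n + 1.  So S can be taken to consist of the
    left-normed commutators of n + 1 elements of l. *)
Lemma lower_central_generators (l : seq G) (n : nat) :
  let K := generated [set` l] in
  exists S : seq G, [set` S] `<=` lower_central K n /\
    lower_central K n `<=` generated ([set` S] `|` lower_central K n.+1).
Proof.
move=> K; have gK : subgroup K := generated_subgroup _.
elim: n => [|n [S [sSL sLS]]].
  exists l; split; first exact: sub_gen_smallest.
  apply: smallest_sub; first exact: generated_subgroup.
  by move=> x lx; apply: sub_gen_smallest; left.
exists [seq [~ s, t] | s <- S, t <- l]; split.
  move=> _ /= /allpairsP[[s t] /= [Ss lt ->]]; apply: lower_central_comm.
    exact: sSL.
  exact: sub_gen_smallest.
set Q := generated _.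
have gQ : subgroup Q := generated_subgroup _.
have [_ QM QV] := (subgroupP Q).1 gQ.
have sQL : Q `<=` lower_central K n.+1.
  apply: smallest_sub; first exact: lower_central_subgroup.
  move=> x [|]; last exact: lower_central_succ_sub.
  move=> /= /allpairsP[[s t] /= [Ss lt ->]]; apply: lower_central_comm.
    exact: sSL.
  exact: sub_gen_smallest.
(* Writing x ^ h = x * [~ x, h], the second factor lies in a term of the
   series that Q contains. *)
have nQK x h : Q x -> K h -> Q (x ^ h).
  move=> Qx Kh; rewrite -(mulVKg x (x ^ h)); apply: (QM) => //.
  by apply: sub_gen_smallest; right; apply: lower_central_comm => //; apply: sQL.
apply: smallest_sub => // _ [x Lx [y Ky <-]].
suff /(_ x Lx) [_ /(_ _ Ky)] : lower_central K n `<=`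
    [set x | K x /\ forall a, K a -> Q [~ x, a]] by [].
apply: subset_trans sLS _; apply: smallest_sub.
  exact: commutator_mod_subgroup.
move=> s [Ss|Ls]; last first.
  split=> [|a Ka]; first exact: lower_central_sub Ls.
  by apply: sub_gen_smallest; right; apply: lower_central_comm.
split=> [|a Ka]; first by apply: lower_central_sub (sSL s Ss).
rewrite -invgR; apply: (QV).
suff /(_ a Ka) [_ /(_ s)] :
  K `<=` [set x | K x /\ forall b, [set s] b -> Q [~ x, b]] by apply.
apply: smallest_sub; first exact: commutator_mod_subgroup.
move=> t lt; split=> [|_ ->]; first exact: sub_gen_smallest.
rewrite -invgR; apply: (QV); apply: sub_gen_smallest; left => /=.
by apply/allpairsP; exists (s, t).
Qed.

(** * Subgroups of finite index *)

Lemma finite_range_representatives (U : choiceType) (f : G -> U) :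
  finite_set (range f) ->
  exists T : seq G, forall x, exists2 t, t \in T & f t = f x.
Proof.
move=> /finite_seqP[s fs].
have /choice[g gf] : forall u, exists x, u \in s -> f x = u.
  move=> u.
  have [us|] := boolP (u \in s); last by exists 1.
  have : [set` s] u by [].
  by rewrite -fs => -[x _ <-]; exists x.
exists [seq g u | u <- s] => x.
have fxs : f x \in s.
  have : range f (f x) by exists x.
  by rewrite fs.
by exists (g (f x)); [apply: map_f|apply: gf].
Qed.

Lemma finite_indexP H : subgroup H ->
  finite_index H <-> exists T : seq G, forall x, exists2 t, t \in T & H (t^-1 * x).
Proof.
move=> /subgroupP[H1 HM HV]; split.
  move=> /finite_range_representatives[T repT]; exists T => x.
  have [t Tt tx] := repT x; exists t => //.
  have : left_coset H x x by exists 1; rewrite ?mulg1.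
  by rewrite -tx => -[h Hh <-]; rewrite mulKg.
move=> [T repT].
apply: (@sub_finite_set _ _ (left_coset H @` [set` T])); last first.
  exact/finite_image/finite_seq.
move=> _ [x _ <-]; have [t Tt Htx] := repT x; exists t => //.
apply/seteqP; split=> _ [h Hh <-].
  exists ((t^-1 * x)^-1 * h); first by apply: HM => //; apply: HV.
  by rewrite invgM invgK -!mulgA mulVKg.
by exists (t^-1 * x * h); [apply: HM|rewrite !mulgA mulgV mul1g].
Qed.

Lemma finite_index_coloring (U : choiceType) (f : G -> U) H : subgroup H ->
    finite_set (range f) -> (forall x y, f x = f y -> H (x^-1 * y)) ->
  finite_index H.
Proof.
move=> gH /finite_range_representatives[T repT] fH.
apply/finite_indexP => //; exists T => x; have [t Tt tx] := repT x.
by exists t => //; apply: fH.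
Qed.

(** A transversal T of H is moved by a generator of G into T up to an element of
    H.  The finitely many elements of H that arise generate a subgroup K such
    that T K is stable under G, hence is all of G. *)
Lemma Schreier H : finitely_generated G -> subgroup H -> finite_index H ->
  exists l : seq G, [set` l] `<=` H /\ finite_index (generated [set` l]).
Proof.
move=> [s sG] gH /finite_indexP [] // T repT.
have /choice[r rT] : forall x, exists t, t \in T /\ H (t^-1 * x).
  by move=> x; have [t] := repT x; exists t.
pose S := s ++ [seq a^-1 | a <- s].
(* The first generator puts 1 in T K, as 1 need not be in T. *)
pose l := ((r 1)^-1 * 1) :: [seq (r (a * t))^-1 * (a * t) | a <- S, t <- T].
exists l; split.
  move=> x /=; rewrite inE => /orP[/eqP->|/allpairsP[[a t] /= [_ _ ->]]];
  exact: (rT _).2.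
set K := generated _.
have [K1 KM KV] := (subgroupP K).1 (generated_subgroup _).
pose TK := [set x | exists2 t, t \in T & K (t^-1 * x)].
have TKS a x : a \in S -> TK x -> TK (a * x).
  move=> Sa [t Tt Ktx]; exists (r (a * t)); first by case: (rT (a * t)).
  have -> : (r (a * t))^-1 * (a * x) = ((r (a * t))^-1 * (a * t)) * (t^-1 * x).
    by rewrite -!mulgA mulVKg.
  apply: (KM) => //; apply: sub_gen_smallest; rewrite /= inE; apply/orP; right.
  by apply/allpairsP; exists (a, t).
have TK1 : TK 1.
  exists (r 1); first by have [] := rT 1.
  by apply: sub_gen_smallest; rewrite /= inE eqxx.
pose X := [set g : G | forall x, TK x -> TK (g * x) /\ TK (g^-1 * x)].
have XT : setT `<=` X.
  rewrite -sG; apply: smallest_sub.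
    apply/subgroupP; split=> [x|g h Xg Xh x TKx|g Xg x TKx].
    - by rewrite invg1 !mul1g.
    - rewrite invgM -!mulgA; split; first by apply Xg; apply Xh.
      by apply Xh; apply Xg.
    - by rewrite invgK; have [] := Xg x TKx.
  move=> a sa x TKx; split; apply: TKS => //; rewrite mem_cat.
    by apply/orP; left.
  by rewrite map_f ?orbT.
apply/finite_indexP; first exact: generated_subgroup.
exists T => x; have [] := XT x I _ TK1.
by rewrite mulg1.
Qed.

Lemma centralizer_subgroup K g :
  subgroup K -> subgroup [set x | K x /\ commute x g].
Proof.
move=> /subgroupP[K1 KM KV]; apply/subgroupP; split.
- by split=> //; apply/commute_sym/commute1.
- move=> x y [Kx cx] [Ky cy]; split; first exact: KM.
  by apply/commute_sym/commuteM; apply: commute_sym.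
- move=> x [Kx cx]; split; first exact: KV.
  exact/commute_sym/commuteV/commute_sym.
Qed.

Lemma set1_subgroup : subgroup [set 1 : G].
Proof. by apply/subgroupP; split=> // [_ _ -> ->|_ ->]; rewrite ?mulg1 ?invg1. Qed.

(** The commutators of g with K correspond to the conjugates of g under K, hence
    to the cosets in K of the centralizer of g. *)
Lemma finite_index_centralizer K g : subgroup K -> finite_index K ->
  finite_set [set [~ g, h] | h in K] ->
  finite_index [set x | K x /\ commute x g].
Proof.
move=> gK /finite_indexP [] // T repT finC.
have [K1 KM KV] := (subgroupP K).1 gK.
have /choice[r rT] : forall x, exists t, t \in T /\ K (t^-1 * x).
  by move=> x; have [t] := repT x; exists t.
(* The colour of x records its coset representative and the effect of the
   remaining factor in K on g.  That factor is inverted because conjugation is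
   a right action, whereas the index is counted with left cosets. *)
apply: (@finite_index_coloring _ (fun x => (r x, [~ g, ((r x)^-1 * x)^-1]))).
- exact: centralizer_subgroup.
- apply: (@sub_finite_set _ _ ([set` T] `*` [set [~ g, h] | h in K])).
    move=> _ [x _ <-]; have [Tx Kx] := rT x; split=> //=.
    by exists ((r x)^-1 * x)^-1 => //; apply: (KV).
  by apply: finite_setX => //; apply: finite_seq.
- move=> x y [rxy]; have [_ Kx] := rT x; have [_ Ky] := rT y.
  move: Kx Ky; rewrite -rxy; set a := _ * x; set b := _ * y => Ka Kb /mulgI gab.
  have -> : x^-1 * y = a^-1 * b by rewrite /a /b invgM invgK -!mulgA mulVKg.
  split; first by apply: (KM) => //; apply: (KV).
  apply/commute_sym/commgP/conjg_fixP.
  by rewrite conjgM gab conjgKV.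
Qed.

(** The products of powers of the elements of l form a subgroup, and each exponent
    only matters modulo the order of its element. *)
Lemma finite_generated_torsion (l : seq G) :
    {in l &, forall x y, commute x y} ->
    (forall x, x \in l -> exists n : nat, (0 < n)%N /\ x ^+ n = 1) ->
  finite_set (generated [set` l]).
Proof.
move=> cl tl.
(* The last clause makes the subgroup built so far commute with the next
   element of l. *)
suff [P [gP lP fP _]] : exists P, [/\ subgroup P, [set` l] `<=` P, finite_set P
    & forall z, (forall x, x \in l -> commute z x) -> forall y, P y -> commute z y].
  by apply: sub_finite_set fP; apply: smallest_sub.
elim: l cl tl => [|x l IHl] cl tl.
  exists [set 1]; split=> //.
  - exact: set1_subgroup.
  - by move=> z _ _ ->; apply: commute1.
have {IHl}[|y ly|P [gP lP fP cP]] := IHl.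
- by move=> y z ly lz; apply: cl; rewrite inE ?ly ?lz orbT.
- by apply: tl; rewrite inE ly orbT.
have [n [n0 xn]] := tl x (mem_head _ _).
have [P1 PM PV] := (subgroupP P).1 gP.
have cx y : P y -> commute x y.
  by apply: cP => z lz; apply: cl; rewrite inE ?eqxx ?lz ?orbT.
exists [set z | exists2 e : nat, True & exists2 y, P y & z = x ^+ e * y]; split.
- apply/subgroupP; split.
  + by exists 0%N => //; exists 1; rewrite ?mulg1.
  + move=> _ _ [e _ [y Py ->]] [f _ [z Pz ->]]; exists (e + f)%N => //.
    exists (y * z); first exact: PM.
    rewrite expgnDr -!mulgA; congr (_ * _); rewrite !mulgA; congr (_ * _).
    by apply/commuteX/commute_sym/cx.
  + move=> _ [e _ [y Py ->]]; exists (n.-1 * e)%N => //; exists y^-1; first exact: PV.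
    rewrite invgM expgnA.
    have -> : x ^+ n.-1 = x^-1.
      by apply: (mulgI x); rewrite -expgS prednK // xn mulgV.
    rewrite expVgn; apply/commute_sym/commuteV/commute_sym/commuteV/commute_sym.
    exact/commute_sym/commuteX/commute_sym/cx.
- move=> z /=; rewrite inE => /orP[/eqP->|lz].
    by exists 1%N => //; exists 1; rewrite ?mulg1 ?expg1n.
  by exists 0%N => //; exists z; rewrite ?mul1g //; apply: lP.
- apply: (@sub_finite_set _ _ [set x ^+ e * y | e in `I_n & y in P]); last first.
    by apply: finite_image2 => //; apply: finite_II.
  move=> _ [e _ [y Py ->]]; exists (e %% n)%N => /=; first by rewrite ltn_mod.
  by exists y => //; rewrite {2}(divn_eq e n) mulnC expgnDr expgnA xn expg1n mul1g.
- move=> z cz _ [e _ [y Py ->]]; apply: commuteM.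
    by apply/commuteX/cz; rewrite mem_head.
  by apply: cP => // w lw; apply: cz; rewrite inE lw orbT.
Qed.

Lemma finite_index_common_centralizer K (S : seq G) : subgroup K -> finite_index K ->
    (forall g, g \in S -> finite_set [set [~ g, h] | h in K]) ->
  exists L, [/\ subgroup L, finite_index L, L `<=` K
    & forall g x, g \in S -> L x -> commute x g].
Proof.
move=> gK fK; elim: S => [|g S IHS] fS; first by exists K; split.
have [|L [gL fL sLK cL]] := IHS; first by move=> h Sh; apply: fS; rewrite inE Sh orbT.
exists [set x | L x /\ commute x g]; split.
- exact: centralizer_subgroup.
- apply: finite_index_centralizer => //.
  apply: sub_finite_set (fS g (mem_head _ _)).
  by move=> _ [h Lh <-]; exists h => //; apply: sLK.
- by move=> x [Lx _]; apply: sLK.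
- move=> h x; rewrite inE => /orP[/eqP-> [_] //|Sh [Lx _]]; exact: cL.
Qed.

(** * Nilpotent groups without Heisenberg pairs *)

(** Induction on c: when c is at least 2, passing to the common centralizer of
    finitely many elements yields a subgroup of finite index with smaller c. *)
Lemma virtually_abelian_of_nilpotent H c :
    finitely_generated G -> no_Heisenberg_pair G ->
    subgroup H -> finite_index H -> lower_central H c `<=` [set 1] ->
  virtually_abelian G.
Proof.
move=> fgG noH; elim: c H => [|[|n] IHc] H gH fH nilH.
- by exists H; split=> // x y /nilH -> /nilH ->.
- exists H; split=> // x y Hx Hy; apply/commgP/eqP/nilH.
  exact: (@lower_central_comm H 0).
have [l [lH fK]] := Schreier fgG gH fH.
have gK := generated_subgroup [set` l].
have [S [SL LS]] := lower_central_generators l n.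
set K := generated _ in fK gK SL LS.
have sKH : K `<=` H by apply: smallest_sub.
have nilK : lower_central K n.+2 `<=` [set 1].
  by apply: subset_trans nilH; apply: lower_centralS.
have centr u k : lower_central K n.+1 u -> K k -> commute u k.
  by move=> Lu Kk; apply/commgP/eqP/nilK; apply: lower_central_comm.
have sLK m : lower_central K m `<=` K by apply: lower_central_sub.
have [g Sg|L [gL fL sLK' cL]] := finite_index_common_centralizer (S := S) gK fK.
  have Kg : K g by apply: (sLK n); apply: SL.
  have comm_in h : K h -> lower_central K n.+1 [~ g, h].
    by move=> Kh; apply: lower_central_comm => //; apply: SL.
  (* As h |-> [~ g, h] is multiplicative, its values on generators suffice. *)
  pose T := generated [set` [seq [~ g, s] | s <- l]].
  have gT : subgroup T := generated_subgroup _.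
  have [_ _ TV] := (subgroupP T).1 gT.
  have lK s : s \in l -> K s by move=> ls; apply: sub_gen_smallest.
  have TL : T `<=` lower_central K n.+1.
    apply: smallest_sub; first exact: lower_central_subgroup.
    by move=> _ /= /mapP[s ls ->]; apply: comm_in; apply: lK.
  apply: (@sub_finite_set _ _ T); last first.
    apply: finite_generated_torsion.
      move=> _ _ /mapP[s ls ->] /mapP[t lt ->].
      by apply: centr; [|apply: (sLK n.+1)]; apply: comm_in; apply: lK.
    move=> _ /mapP[s ls ->]; apply: noH; apply/commute_sym/centr => //;
    by [apply: comm_in; apply: lK|apply: lK].
  move=> _ [h Kh <-]; rewrite -invgR; apply: (TV).
  suff /(_ h Kh) [_ /(_ g)] :
    K `<=` [set x | K x /\ forall b, [set g] b -> T [~ x, b]] by apply.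
  apply: smallest_sub.
    apply: commutator_mod_subgroup => // x k Tx Kk.
    suff -> : x ^ k = x by [].
    by apply/conjg_fixP/commgP/centr => //; apply: TL.
  move=> s ls; split=> [|_ ->]; first exact: lK.
  by rewrite -invgR; apply: (TV); apply: sub_gen_smallest; apply: map_f.
(* L centralizes S by construction and the term n.+1 by centrality, hence also
   the term n of K, which they generate. *)
apply: (IHc L) => //; apply: smallest_sub.
  exact: set1_subgroup.
move=> _ [x Lx [y Ly <-]].
have {}Lx : lower_central K n x by apply: lower_centralS Lx.
suff /(_ x Lx) [_ /(_ y Ly)] : lower_central K n `<=`
    [set x | K x /\ forall b, L b -> [set 1] [~ x, b]] by [].
apply: subset_trans LS _; apply: smallest_sub.
  apply: commutator_mod_subgroup => // [|_ h -> _]; first exact: set1_subgroup.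
  by rewrite conj1g.
move=> s [Ss|Ls]; split=> [|b Lb].
- by apply: (sLK n); apply: SL.
- by apply/eqP/commgP/commute_sym/cL.
- exact: sLK Ls.
- by apply/eqP/commgP/centr => //; apply: sLK'.
Qed.
End GroupTheory.

(** * Heisenberg pairs *)

Section HeisenbergPair.
(* The commutator z is a variable because associativity, used as a rewrite rule,
   sees through the definition of [~ x, y]. *)
Variables (G : groupType) (x y z : G).
Local Open Scope group_scope.
Hypotheses (zE : [~ x, y] = z) (cxz : commute x z) (cyz : commute y z).

Lemma conjg_Heisenberg_l a : (x ^+ a) ^ y = x ^+ a * z ^+ a.
Proof. by rewrite conjXg -expgMn // -zE mulVKg. Qed.

Lemma conjg_Heisenberg_r b : (y ^+ b) ^ x^-1 = y ^+ b * z ^+ b.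
Proof.
rewrite conjXg -expgMn //; congr (_ ^+ b).
by rewrite /conjg invgK mulgA (commgC x y) zE -(mulgA y x) cxz mulgA mulgK.
Qed.

Lemma expg_Heisenberg a b : x ^+ a * y ^+ b = y ^+ b * x ^+ a * z ^+ (a * b).
Proof.
have xyb : x ^ (y ^+ b) = x * z ^+ b.
  elim: b => [|b IHb]; first by rewrite conjg1 mulg1.
  rewrite expgSr conjgM IHb conjMg conjXg /=.
  have -> : z ^ y = z by apply/conjg_fixP/commgP/commute_sym.
  by rewrite (_ : x ^ y = x * z) -?mulgA -?expgS // -zE mulVKg.
rewrite [LHS]conjgC conjXg xyb expgMn; last exact: commuteX.
by rewrite mulnC expgnA mulgA.
Qed.

Lemma Heisenberg_word a b :
  x ^+ a * y ^+ b * x^-1 ^+ a * y^-1 ^+ b * z^-1 ^+ (a * b) = 1.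
Proof.
have cz : commute (z ^+ (a * b)) (y ^+ b * x ^+ a).
  by apply: commuteM; apply: commuteX2; apply: commute_sym.
by rewrite expg_Heisenberg -cz !expVgn mulgA !mulgK mulgV.
Qed.

(** Conjugation by y, resp. x^-1, multiplies by a power of z that detects the
    exponent of x, resp. y.  Comparing the two sides of
    x^a y^b = z^e y^d x^c gives a = c and b = d, and what remains is
    z^(ab) = z^e. *)
Lemma Heisenberg_relation a b c d e :
    (forall n : nat, (0 < n)%N -> z ^+ n <> 1) ->
    x ^+ a * y ^+ b * x^-1 ^+ c * y^-1 ^+ d * z^-1 ^+ e = 1 ->
  (a * b)%N = e.
Proof.
move=> infz; have zI m n : z ^+ m = z ^+ n -> m = n.
  wlog le_mn : m n / (m <= n)%N => [hw|zmn].
    by case/orP: (leq_total m n) => [/hw //|/hw h /esym /h].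
  apply/eqP; rewrite eqn_leq le_mn leqNgt /= -subn_gt0; apply/negP => /infz.
  by rewrite expgnFr // zmn mulgV.
have conjX (g h : G) m : commute h g -> (h ^+ m) ^ g = h ^+ m.
  by move=> chg; apply/conjg_fixP/commgP/commute_sym/commuteX/commute_sym.
have cxx := commute_refl x; have cyy := commute_refl y.
have cxzX m n : x ^+ m * z ^+ n = z ^+ n * x ^+ m by apply: commuteX2.
have cyzX m n : y ^+ m * z ^+ n = z ^+ n * y ^+ m by apply: commuteX2.
have czy := commute_sym cyz; have czx := commute_sym cxz.
rewrite !expVgn => /divg1_eq/eqP; rewrite !divg_eq => /eqP.
rewrite expg_Heisenberg.
set u := y ^+ b * x ^+ a * z ^+ (a * b) => eq1.
have ac : a = c.
  apply: zI; apply: (@mulgI _ u).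
  have -> : u * z ^+ a = u ^ y.
    rewrite /u !conjMg conjg_Heisenberg_l !conjX //.
    by rewrite -!mulgA -!expgnDr addnC.
  rewrite eq1 !conjMg conjg_Heisenberg_l !conjX //.
  by rewrite !mulgA.
have bd : b = d.
  apply: zI; apply: (@mulgI _ u).
  have cXz : commute z x^-1 by apply/commuteV/commute_sym.
  have cXx : commute x x^-1 by apply/commuteV.
  have -> : u * z ^+ b = u ^ x^-1.
    rewrite /u !conjMg conjg_Heisenberg_r !conjX //.
    by rewrite -!mulgA (mulgA (z ^+ b)) -cxzX -!mulgA -!expgnDr addnC.
  rewrite eq1 !conjMg conjg_Heisenberg_r !conjX //.
  by rewrite -!mulgA -cxzX.
apply: zI; apply: (@mulgI _ (y ^+ b * x ^+ a)); rewrite -/u eq1 -ac -bd.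
by rewrite -!mulgA cxzX !mulgA -cyzX.
Qed.
End HeisenbergPair.

(** * Semilinear sets and multiplication *)

Section SemilinearSets.
Local Open Scope ring_scope.
Variables (k : nat) (i j l : 'I_k).
Implicit Types (A B : set 'rV[nat]_k).

Lemma smallest_submonoid A : submonoid (smallest (@submonoid k) A).
Proof.
split=> [|u v /set_mem Au /set_mem Av]; apply: mem_set => M [gM sAM].
  exact: set_mem gM.1.
by apply: set_mem; apply: gM.2; apply: mem_set; [apply: Au|apply: Av].
Qed.

(** For a period t, comparing the relation at v0, v0 + t and v0 + 2 t gives
    t i * t j = 0.  Applied to u, u' and u + u', this shows that either i or j
    vanishes on both u and u'. *)
Lemma linear_set_diagonal B v w : linear_set B ->
    (forall u, B u -> (u ord0 i * u ord0 j)%N = u ord0 l) ->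
    B v -> B w -> v ord0 i = v ord0 j -> w ord0 i = w ord0 j ->
  v ord0 i = w ord0 i.
Proof.
move=> [v0 [vs ->]]; set M := smallest _ _ => prodB [u Mu <-] [u' Mu' <-].
have [M0 MD] : submonoid M := smallest_submonoid _.
have {}MD s t : M s -> M t -> M (s + t).
  by move=> Ms Mt; apply/set_mem/MD; apply: mem_set.
have rel t : M t ->
    ((v0 ord0 i + t ord0 i) * (v0 ord0 j + t ord0 j) = v0 ord0 l + t ord0 l)%N.
  move=> Mt; have /prodB : [set v0 + v | v in M] (v0 + t) by exists t.
  by rewrite !mxE.
have rel0 := rel _ (set_mem M0).
have prod0 t : M t -> (t ord0 i * t ord0 j = 0)%N.
  move=> Mt; have := rel _ Mt; have := rel _ (MD _ _ Mt Mt).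
  move: rel0; rewrite !mxE; move: (v0 ord0 i) (v0 ord0 j) (v0 ord0 l).
  by move: (t ord0 i) (t ord0 j) (t ord0 l) => p q r a b c; nia.
have := prod0 _ Mu; have := prod0 _ Mu'; have := prod0 _ (MD _ _ Mu Mu').
rewrite !mxE; move: (u ord0 i) (u ord0 j) (u' ord0 i) (u' ord0 j).
by move: (v0 ord0 i) (v0 ord0 j) => a b p q p' q'; nia.
Qed.

(** The points with coordinates i and j both equal to n, for n = 0 .. m, would
    lie in pairwise different members of a family of m linear sets. *)
Lemma multiplication_graph_not_semilinear A :
    (forall v, A v -> (v ord0 i * v ord0 j)%N = v ord0 l) ->
    (forall n : nat, exists v, [/\ A v, v ord0 i = n & v ord0 j = n]) ->
  ~ semilinear_set A.
Proof.
move=> prodA diagA [m [B [linB AB]]].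
have /choice[c cP] : forall n : nat,
    exists r, exists v, [/\ B r v, v ord0 i = n & v ord0 j = n].
  move=> n; have [v []] := diagA n; rewrite AB => -[r _ Bv] vi vj.
  by exists r, v.
have inj_c : injective (fun n : 'I_m.+1 => c n).
  move=> n n' eq_c; apply: val_inj => /=.
  have [v [Bv vi vj]] := cP n; have [w [Bw wi wj]] := cP n'.
  rewrite -{1}vi -wi; apply: (linear_set_diagonal (linB (c n))) => //.
  - by move=> u Bu; apply: prodA; rewrite AB; exists (c n).
  - by rewrite eq_c.
  - by rewrite vi vj.
  - by rewrite wi wj.
by have := leq_card _ inj_c; rewrite !card_ord ltnn.
Qed.

End SemilinearSets.

(** * Words with letters in increasing order *)

Section SortedWords.
Variable n : nat.
Local Open Scope nat_scope.

Lemma card_ord_gt0 : 0 < #|'I_n.+1|.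
Proof. by rewrite card_ord. Qed.

Definition ordinal_alphabet : alphabet := Alphabet card_ord_gt0.

Definition block_word (c : 'I_n.+1 -> nat) : seq ordinal_alphabet :=
  flatten [seq nseq (c i) i | i <- enum 'I_n.+1].

Definition sorted_words : language ordinal_alphabet :=
  [set w | sorted leq [seq val i | i <- w]].

(** The state is the last letter read, and [None] is the rejecting sink. *)
Definition sorted_step (s : option 'I_n.+1) (j : ordinal_alphabet) :=
  if s is Some i then if i <= j then Some j else None else None.

Lemma regular_sorted_words : regular sorted_words.
Proof.
exists (@Automaton ordinal_alphabet (option 'I_n.+1) (Some ord0) [set~ None]%SET
  sorted_step).
have sink w : foldl sorted_step None w = None by elim: w.
have run w (i : 'I_n.+1) :
    (foldl sorted_step (Some i) w != None) = path leq i [seq val j | j <- w].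
  elim: w i => [|j w IHw] i //=; case: leqP => _ //=.
  by rewrite sink.
have acc (w : seq ordinal_alphabet) :
    (foldl sorted_step (Some ord0) w \in [set~ None]%SET) =
      sorted leq [seq val j | j <- w].
  by rewrite finset.in_setC1 run; case: w => //= j w.
by apply/seteqP; split=> w /=; rewrite /sorted_words /= -acc.
Qed.

Lemma count_block_word c i : count_mem i (block_word c) = c i.
Proof.
rewrite /block_word count_flatten sumnE 2!big_map big_enum /=.
rewrite (bigD1 i) //= count_nseq /= eqxx mul1n big1 ?addn0 // => j /negPf ji.
by rewrite count_nseq /= ji.
Qed.

Lemma block_word_sorted c : sorted_words (block_word c).
Proof.
have: sorted leq [seq val i | i <- enum 'I_n.+1] by rewrite val_enum_ord iota_sorted.
rewrite /sorted_words /block_word /= !(sorted_pairwise leq_trans).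
elim: (enum _) => //= i s IHs /andP[/allP le_is /IHs{}IHs].
rewrite map_cat pairwise_cat IHs andbT; apply/andP; split.
  apply/allrelP => _ b /mapP[j /nseqP[-> _] ->] /mapP[j' /flatten_mapP[i' si']].
  by case/nseqP=> -> _ ->; apply/le_is/map_f.
by rewrite map_nseq; elim: (c i) => //= m IHm; rewrite IHm andbT all_nseq leqnn orbT.
Qed.

Lemma sorted_word_block (w : seq ordinal_alphabet) :
  sorted_words w -> w = block_word (fun i => count_mem i w).
Proof.
move=> w_sorted; apply: (inj_map val_inj).
apply: (sorted_eq leq_trans anti_leq) => //; first exact: block_word_sorted.
apply: perm_map; apply/allP => i _ /=; apply/eqP; apply: esym.
exact: count_block_word.
Qed.
End SortedWords.

Lemma parikh_coord (Sigma : alphabet) (a : Sigma) (w : seq Sigma) :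
  parikh w ord0 (enum_rank a) = count_mem a w.
Proof. by rewrite mxE enum_rankK. Qed.

(** * Languages of a group with a Heisenberg pair *)

Section Words.
Variables (G : groupType) (Sigma : alphabet) (pi : seq Sigma -> G).
Local Open Scope group_scope.
Hypotheses (pi0 : pi [::] = 1) (piM : {morph pi : u v / u ++ v >-> u * v}).

Lemma pi_flatten_nseq (u : seq Sigma) m : pi (flatten (nseq m u)) = pi u ^+ m.
Proof. by elim: m => //= m IHm; rewrite piM IHm expgS. Qed.

Lemma word_morphism_subst (S : alphabet) (f : S -> seq Sigma) :
  word_morphism (fun w : seq S => flatten [seq f i | i <- w]).
Proof. by split=> // u v; rewrite map_cat flatten_cat. Qed.

Lemma pi_subst_block_word n (f : 'I_n.+1 -> seq Sigma) (c : 'I_n.+1 -> nat) :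
  pi (flatten [seq f i | i <- block_word c]) =
    \prod_(i <- enum 'I_n.+1) pi (f i) ^+ c i.
Proof.
rewrite /block_word; elim: (enum _) => [|i s IHs]; first by rewrite big_nil.
by rewrite big_cons /= map_cat flatten_cat piM map_nseq pi_flatten_nseq IHs.
Qed.

(** A Heisenberg pair would put a language with Parikh image
    {(a, b, a, b, ab)} in the cone. *)
Lemma cone_no_Heisenberg (C : language_class) :
    cone C ->
    (forall (S : alphabet) (L : language S), C S L -> semilinear_language L) ->
    (forall g, exists w, pi w = g) -> C Sigma (word_problem pi) ->
  no_Heisenberg_pair G.
Proof.
move=> hC hsemi pi_surj hWP x y cxz cyz; apply: contrapT => no_n.
set z := [~ x, y] in cxz cyz no_n.
have infz n : (0 < n)%N -> z ^+ n <> 1 by move=> n0 zn; apply: no_n; exists n.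
pose g (i : 'I_5) := nth 1 [:: x; y; x^-1; y^-1; z^-1] i.
have /choice[f fg] : forall i, exists w, pi w = g i by move=> i; apply: pi_surj.
have fM := word_morphism_subst (S := ordinal_alphabet 4) f.
have hL := cone_regular hC (cone_preimage hC fM hWP) (regular_sorted_words 4).
set L := _ `&` _ in hL.
have enum5 : enum 'I_5 = [:: inord 0; inord 1; inord 2; inord 3; inord 4].
  by apply: (inj_map val_inj); rewrite val_enum_ord /= !inordK.
have piE c : pi (flatten [seq f i | i <- block_word c]) =
    x ^+ c (inord 0) * y ^+ c (inord 1) * x^-1 ^+ c (inord 2) *
    y^-1 ^+ c (inord 3) * z^-1 ^+ c (inord 4).
  rewrite pi_subst_block_word enum5 !big_cons big_nil !fg /g !inordK //=.
  by rewrite !mulgA mulg1.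
pose r (i : nat) : 'I_#|ordinal_alphabet 4| := enum_rank (inord i : ordinal_alphabet 4).
have := hsemi _ _ hL; apply: (@multiplication_graph_not_semilinear _ (r 0) (r 1%N) (r 4)).
  move=> _ [w [WPw /sorted_word_block wE] <-]; rewrite !parikh_coord.
  have {WPw} : pi (flatten [seq f i | i <- w]) = 1 := WPw.
  by rewrite {1}wE piE; apply: (Heisenberg_relation (erefl z)).
move=> n; pose c (i : 'I_5) := nth 0%N [:: n; n; n; n; n * n]%N i.
exists (parikh (block_word c : seq (ordinal_alphabet 4))).
rewrite !parikh_coord !count_block_word /c !inordK //; split=> //.
exists (block_word c) => //; split; last exact: block_word_sorted.
by rewrite /word_problem /= piE /c !inordK //=; apply: Heisenberg_word.
Qed.
End Words.

(** * Virtually nilpotent groups *)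

Theorem theorem5 (C : language_class) (hC : cone C)
  (hsemi : forall (S : alphabet) (L : language S), C S L -> semilinear_language L)
  (G : groupType) (hfg : finitely_generated G) (hnil : virtually_nilpotent G)
  (Sigma : alphabet) (inv : Sigma -> Sigma) (pi : seq Sigma -> G)
  (hgen : choice_of_generators inv pi)
  (hWP : C Sigma (word_problem pi)) :
  virtually_abelian G.
Proof.
have [H [gH fH [c nilH]]] := hnil.
have [[pi0 piM] pi_surj] :=
  (generators_nil hgen, generators_cat hgen, generators_surjective hgen).
have noH := cone_no_Heisenberg pi0 piM hC hsemi pi_surj hWP.
apply: (virtually_abelian_of_nilpotent hfg noH gH fH (c := c)).
by rewrite nilH.
Qed.
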